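(* Let $\beta\in(0,1]$. The mapping $$\mathcal N_{\mathbb C}\ni\varphi\mapsto l_{\mu_\beta}(\varphi)=\int_{\mathcal N'}e^{\langle\omega,\varphi\rangle}\,d\mu_\beta(\omega)\in\mathbb C$$ is a holomorphic mapping from $\mathcal N_{\mathbb C}$ to $\mathbb C$.
   Context: Nuclear triple: $\mathcal H$ is a real separable Hilbert space with inner product $(\cdot,\cdot)$ and norm $|\cdot|=|\cdot|_0$. For $p\in\mathbb N_0$, $\mathcal H_p$ is a real separable Hilbert space with norm $|\cdot|_p$, $\mathcal H_0=\mathcal H$, with continuous dense Hilbert–Schmidt inclusions $\mathcal H_{p+1}\subset\mathcal H_p$ and $|\cdot|_p\le|\cdot|_{p+1}$ on $\mathcal H_{p+1}$. $\mathcal N=\bigcap_p\mathcal H_p$ with the projective limit topology is a nuclear space, continuously and densely embedded in $\mathcal H$; $\mathcal N'$ is its dual, $\langle\cdot,\cdot\rangle$ is the dual pairing, and $\langle f,\varphi\rangle=(f,\varphi)$ for $f\in\mathcal H,\varphi\in\mathcal N$. $\mathcal N_{\mathbb C}$ is the complexification of $\mathcal N$ and $\langle\cdot,\cdot\rangle$ is extended complex bilinearly. Mittag-Leffler function: $\mathrm E_\beta(z)=\sum_{n\ge0}z^n/\Gamma(\beta n+1)$. For $\beta\in(0,1]$, $\mu_\beta$ is the unique probability measure on $\mathcal N'$ with its cylinder $\sigma$-algebra such that $\int_{\mathcal N'}\exp(i\langle\omega,\varphi\rangle)\,d\mu_\beta(\omega)=\mathrm E_\beta(-\tfrac12\langle\varphi,\varphi\rangle)$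 for all $\varphi\in\mathcal N$. A map $F:\mathcal N_{\mathbb C}\to\mathbb C$ is holomorphic iff it is locally bounded and G-holomorphic, i.e. $z\mapsto F(\varphi_0+z\varphi)$ is holomorphic on $\mathbb C$ for all $\varphi_0,\varphi\in\mathcal N_{\mathbb C}$. *)

(* Defs.v *)
From HB Require Import structures.
From mathcomp Require Import all_boot all_order all_algebra.
From mathcomp Require Import all_classical all_reals all_analysis.
From mathcomp Require Import complex.

Set Implicit Arguments.
Unset Strict Implicit.
Unset Printing Implicit Defensive.

Import Order.TTheory GRing.Theory Num.Theory.
Import numFieldNormedType.Exports.

Local Open Scope classical_set_scope.
Local Open Scope complex_scope.
Local Open Scope ring_scope.

HB.mixin Record CompleteNormedModule_isHilbert (R : realType) (H : Type)
    & CompleteNormedModule R H := {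
  inner : H -> H -> R;
  innerC : forall x y, inner x y = inner y x;
  inner_linearl : forall (a : R) x y z,
    inner (a *: x + y) z = a * inner x z + inner y z;
  inner_norm : forall x, inner x x = `|x| ^+ 2 }.

#[short(type="hilbertType")]
HB.structure Definition Hilbert (R : realType) :=
  {H of CompleteNormedModule R H & CompleteNormedModule_isHilbert R H}.

Definition separable_space (T : topologicalType) : Prop :=
  exists2 D : set T, countable D & dense D.

(* Completeness is stated as maximality; in a Hilbert space this is the density
   of the linear span. *)
Definition orthonormal_basis (R : realType) (H : hilbertType R) (B : set H) :=
  (forall e f, B e -> B f -> inner e f = (e == f)%:R) /\
  (forall x, (forall e, B e -> inner e x = 0) -> x = 0).

Definition hilbert_schmidt (R : realType) (H K : hilbertType R) (A : H -> K) :=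
  exists2 B : set H, orthonormal_basis B &
    (\esum_(e in B) (`|A e| ^+ 2)%:E < +oo)%E.

(* The central space is [hs 0]; the inclusion of [hs p.+1] into [hs p] is an
   injective linear map. *)
Record nuclear_triple (R : realType) := NuclearTriple {
  hs : nat -> hilbertType R;
  hs_incl : forall p, {linear hs p.+1 -> hs p};
  hs_separable : forall p, separable_space (hs p);
  hs_incl_inj : forall p, injective (hs_incl p);
  hs_incl_continuous : forall p, continuous (hs_incl p);
  hs_incl_dense : forall p, dense (range (hs_incl p));
  hs_incl_hilbert_schmidt : forall p, hilbert_schmidt (hs_incl p);
  hs_incl_norm : forall p (x : hs p.+1), `|hs_incl p x| <= `|x| }.

Section NuclearSpace.
Context {R : realType} (T : nuclear_triple R).

Fixpoint incl0 p : hs T p -> hs T 0 :=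
  match p with
  | 0 => fun x => x
  | q.+1 => fun x => incl0 (hs_incl T q x)
  end.

Lemma incl0_inj p : injective (@incl0 p).
Proof. by elim: p => [//|p IH] x y /= /IH; exact: hs_incl_inj. Qed.

Lemma incl0_linear p (a : R) (x y : hs T p) :
  incl0 (a *: x + y) = a *: incl0 x + incl0 y.
Proof. by elim: p x y => [//|p IH] x y /=; rewrite linearP IH. Qed.

Definition in_nuclear : {pred hs T 0} :=
  fun x => `[< forall p, range (@incl0 p) x >].

Lemma in_nuclear_submod_closed : submod_closed in_nuclear.
Proof.
have incl00 p : incl0 (0 : hs T p) = 0.
  by elim: p => [//|p IH] /=; rewrite linear0.
split=> [|a x y /asboolP xN /asboolP yN]; apply/asboolP => p.
  by exists 0.
have [x' _ <-] := xN p; have [y' _ <-] := yN p.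
by exists (a *: x' + y') => //; rewrite incl0_linear.
Qed.

HB.instance Definition _ :=
  GRing.isSubmodClosed.Build R (hs T 0) in_nuclear in_nuclear_submod_closed.

Record nuclear := Nuclear {
  nuclear_val :> hs T 0;
  nuclear_valP : nuclear_val \in in_nuclear }.

HB.instance Definition _ := [isSub for nuclear_val].
HB.instance Definition _ := [Choice of nuclear by <:].
HB.instance Definition _ := [SubChoice_isSubLmodule of nuclear by <:].

Lemma nuclear_hs (x : nuclear) p : exists y : hs T p, incl0 y = x.
Proof.
by case: x => x /= /asboolP/(_ p) [y _ <-]; exists y.
Qed.

Definition nuclear_coord (x : nuclear) : prod_topology (fun p => hs T p) :=
  fun p => sval (cid (nuclear_hs x p)).

Lemma nuclear_coordP x p : incl0 (nuclear_coord x p) = x.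
Proof. exact: (svalP (cid (nuclear_hs x p))). Qed.

(* The projective limit topology: coarsest one making every inclusion
   [x |-> nuclear_coord x p] into [hs p] continuous. *)
HB.instance Definition _ :=
  Topological.copy nuclear (initial_topology nuclear_coord).

Record nuclear_dual := NuclearDual {
  nuclear_dual_fun :> {linear nuclear -> R^o};
  nuclear_dual_continuous : continuous nuclear_dual_fun }.

HB.instance Definition _ := gen_eqMixin nuclear_dual.
HB.instance Definition _ := gen_choiceMixin nuclear_dual.
HB.instance Definition _ :=
  isPointed.Build nuclear_dual
    (@NuclearDual \0 (fun x => @cst_continuous _ _ 0 x)).

Definition pairing (w : nuclear_dual) (phi : nuclear) : R := w phi.

Definition cylinders : set (set nuclear_dual) :=
  [set C | exists (n : nat) (phi : 'I_n -> nuclear) (B : 'I_n -> set R),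
     (forall i, measurable (B i)) /\
     C = [set w : nuclear_dual | forall i, B i (pairing w (phi i))]].

HB.instance Definition _ :=
  Measurable.copy nuclear_dual (g_sigma_algebraType cylinders).

End NuclearSpace.

Definition complexification (V : Type) : Type := (V * V)%type.

HB.instance Definition _ (V : zmodType) :=
  GRing.Zmodule.copy (complexification V) (V * V)%type.
HB.instance Definition _ (V : topologicalType) :=
  Topological.copy (complexification V) (V * V)%type.

Section Complexification.
Context {R : realType} {V : lmodType R}.

Definition complexification_scale (c : R[i]) (x : complexification V) : complexification V :=
  (complex.Re c *: x.1 - complex.Im c *: x.2,
   complex.Re c *: x.2 + complex.Im c *: x.1).

Lemma complexification_scaleA a b x : complexification_scale a (complexification_scale b x) = complexification_scale (a * b) x.
Proof.
case: a b x => [a1 a2] [b1 b2] [x y]; rewrite /complexification_scale/=; congr pair.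
  rewrite scalerBr scalerDr scalerBl scalerDl !scalerA !opprD -!addrA.
  by congr (_ + _); rewrite [RHS]addrC -addrA.
rewrite scalerBr scalerDr scalerBl scalerDl !scalerA -!addrA.
by congr (_ + _); rewrite [RHS]addrC -addrA.
Qed.

Lemma complexification_scale1 : left_id 1 complexification_scale.
Proof.
by case=> x y; rewrite /complexification_scale/= !scale1r !scale0r subr0 addr0.
Qed.

Lemma complexification_scaleDr : right_distributive complexification_scale +%R.
Proof.
move=> a [x1 x2] [y1 y2]; rewrite /complexification_scale/=; congr pair.
  by rewrite /= !scalerDr opprD addrACA.
by rewrite /= !scalerDr addrACA.
Qed.

Lemma complexification_scaleDl v : {morph complexification_scale^~ v : a b / a + b}.
Proof.
case: v => x y [a1 a2] [b1 b2]; rewrite /complexification_scale/=; congr pair.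
  by rewrite /= !scalerDl opprD addrACA.
by rewrite /= !scalerDl addrACA.
Qed.

HB.instance Definition _ := GRing.Zmodule_isLmodule.Build R[i]
  (complexification V) complexification_scaleA complexification_scale1 complexification_scaleDr complexification_scaleDl.

End Complexification.

HB.instance Definition _ (R : realType) (V : preTopologicalLmodType R) :=
  Topological.on (complexification V).

Definition cexp {R : realType} (z : R[i]) : R[i] :=
  (expR (complex.Re z) * cos (complex.Im z)) +i*
  (expR (complex.Re z) * sin (complex.Im z)).

Definition cintegrable d (T : measurableType d) (R : realType)
    (mu : {measure set T -> \bar R}) (f : T -> R[i]) : Prop :=
  mu.-integrable setT (fun x => (complex.Re (f x))%:E) /\
  mu.-integrable setT (fun x => (complex.Im (f x))%:E).

(* Only meaningful for [cintegrable] functions. *)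
Definition cintegral d (T : measurableType d) (R : realType)
    (mu : {measure set T -> \bar R}) (f : T -> R[i]) : R[i] :=
  (\int[mu]_x complex.Re (f x)) +i* (\int[mu]_x complex.Im (f x)).

Definition gholomorphic {R : realType} (E : lmodType R[i]) (F : E -> R[i]) :=
  forall (phi0 phi : E) (z : R[i]),
    derivable (fun w : R[i]^o => F (phi0 + w *: phi) : R[i]^o) z 1.

Definition locally_bounded {R : realType} (E : topologicalType)
    (F : E -> R[i]) :=
  forall x : E, bounded_near (F : E -> R[i]^o) (nbhs x).

Definition holomorphic {R : realType} (E : preTopologicalLmodType R[i])
    (F : E -> R[i]) :=
  locally_bounded F /\ gholomorphic F.

Definition gamma_fun {R : realType} (x : R) : R :=
  \int[lebesgue_measure]_(t in `]0, +oo[) (t `^ (x - 1) * expR (- t)).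

Definition mittag_leffler {R : realType} (beta : R) (z : R[i]) : R[i] :=
  limn (series (fun n => z ^+ n / (gamma_fun (beta * n%:R + 1))%:C)
        : nat -> R[i]^o).

(* By Minlos' theorem exactly one [mu] satisfies this for each [beta] in
   ]0, 1]. *)
Definition is_mittag_leffler_measure {R : realType} (T : nuclear_triple R)
    (beta : R) (mu : probability (nuclear_dual T) R) : Prop :=
  forall phi : nuclear T,
    cintegral mu (fun w : nuclear_dual T => cexp ('i%C * (pairing w phi)%:C)) =
    mittag_leffler beta (- (2^-1 * inner (phi : hs T 0) phi))%:C.

(* The complex bilinear extension of the dual pairing. *)
Definition cpairing {R : realType} {T : nuclear_triple R} (w : nuclear_dual T)
    (phi : complexification (nuclear T)) : R[i] :=
  pairing w phi.1 +i* pairing w phi.2.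

Definition laplace_transform {R : realType} {T : nuclear_triple R}
    (mu : probability (nuclear_dual T) R) (phi : complexification (nuclear T)) : R[i] :=
  cintegral mu (fun w : nuclear_dual T => cexp (cpairing w phi)).

(* Main.v *)
Require Import Defs.
From mathcomp Require Import all_boot all_order all_algebra.
From mathcomp Require Import all_classical all_reals all_analysis.
From mathcomp Require Import complex.
From mathcomp Require Import measurable_realfun ring lra.

Import Order.TTheory GRing.Theory Num.Theory.
Import numFieldNormedType.Exports.

Local Open Scope classical_set_scope.
Local Open Scope complex_scope.
Local Open Scope ring_scope.

(** Everything follows from exponential moments: if the integral of
    [expR <w, phi>] is finite for every real [phi] and bounded for [phi] in a
    ball of [hs T 0], the Laplace transform is locally bounded, and it may be
    expanded to first order under the integral sign along every complex line.

    The only information on [mu] is its characteristic function.  Fix [phi], let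
    [X w = <w, phi>] and [q = |phi|^2].  Replacing [phi] by [s *: phi] and taking
    real parts, the hypothesis says that the expectation of [cos (s * X)] is the
    power series of [E_beta (- s^2 q / 2)], which converges for every [s]
    because Gamma outgrows every exponential (restrict its integral to
    [[M, M + 1]] with [M] large).

    Moments are read off this series by finite differences instead of
    derivatives, so that nothing has to be differentiated under an integral.
    The second difference with step [h] multiplies [cos (s X)] by
    [- (2 - 2 cos (h X))] ([fdiff_cos]), so the iterated difference of order
    [2 k] at the origin is, up to sign, the expectation of the nonnegative
    variable [(2 - 2 cos (h X))^k], which is comparable to [h^(2k) X^(2k)] as
    soon as [|h X| <= 1] ([sqr_le_cos]).  On the other side, the difference of
    order [2 k] of a monomial of degree [2 n] is at most
    [h^(2k) (2k)! C(2n, 2k)] in absolute value ([ler_norm_fdiff_exp]), and the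
    binomial coefficients of a row add up to at most [4^n].  Summing over [k]
    bounds the partial sums of the expectation of [cosh (X / 2)] by the series
    of the [|a_n| 4^n], where [a_n] are the coefficients of the characteristic
    function.  Fatou's lemma concludes as [h] goes to 0
    ([exponential_moment_le]).  For the Mittag-Leffler measure this gives
    [2 E_beta (8 q)] as a bound of the expectation of [exp X]
    ([expR_pairing_le]); it depends on [phi] through [|phi|_0] only, which is
    continuous on the nuclear space, whence the local boundedness.

    For the complex derivative along [phi] at [psi], write [A] and [B] for the
    pairings with [psi] and [phi].  The second-order Taylor estimate bounds
    [exp (A + h B) - exp A - h B exp A] by a multiple of
    [|h|^2 exp (Re A + 2 |Re B| + 2 |Im B|)], which is dominated by a sum of four
    exponentials of real pairings; integrating, the remainder is quadratic in
    [h] ([laplace_first_order]), so the transform is differentiable. *)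

(** * Forward differences of powers and cosines *)

Fixpoint fdiff {R : pzRingType} (h : R) (j : nat) (f : R -> R) (s : R) : R :=
  if j is j'.+1 then fdiff h j' f (s + h) - fdiff h j' f s else f s.

Lemma fdiff_sum (R : comPzRingType) (h : R) (j : nat) (n : nat) (a : nat -> R)
    (f : nat -> R -> R) (s : R) :
  fdiff h j (fun x => \sum_(0 <= i < n) a i * f i x) s =
  \sum_(0 <= i < n) a i * fdiff h j (f i) s.
Proof.
elim: j s => [//|j IH] s /=; rewrite !IH -sumrB.
by apply: eq_bigr => i _; rewrite mulrBr.
Qed.

Lemma cvg_fdiff (R : realType) (h : R) (j : nat) (u : nat -> R -> R)
    (f : R -> R) :
  (forall s, u n s @[n --> \oo] --> f s) ->
  forall s, fdiff h j (u n) s @[n --> \oo] --> fdiff h j f s.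
Proof. by move=> uf; elim: j => [//|j IH] s /=; apply: cvgB. Qed.

(** The Leibniz rule for multiplication by the identity; it is what makes the
    differences of powers computable by induction on the degree. *)
Lemma fdiff_idM (R : comPzRingType) (h : R) (j : nat) (f : R -> R) (s : R) :
  fdiff h j.+1 (fun x => x * f x) s =
  (s + j.+1%:R * h) * fdiff h j.+1 f s + j.+1%:R * h * fdiff h j f s.
Proof.
elim: j s => [|j IH] s; first by rewrite /=; ring.
by rewrite [LHS]/= -!/(fdiff h j.+1 _ _) !IH /= -[j.+2%:R]natr1; ring.
Qed.

(** The [j]-th difference of [x^m] behaves like [h^j] times the [j]-th derivative
    [j! C(m, j) x^(m - j)].  As long as the nodes lie in the unit ball, the
    Leibniz rule reduces the estimate to Pascal's rule. *)
Lemma ler_norm_fdiff_exp (R : realDomainType) (h s : R) (j m : nat) : 0 <= h ->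
  (forall i, (i <= j)%N -> `|s + i%:R * h| <= 1) ->
  `|fdiff h j (fun x => x ^+ m) s| <= h ^+ j * (j`! * 'C(m, j))%:R.
Proof.
move=> h0; elim: m j => [|m IH] [|j] sj.
- by rewrite /= normr1 bin0 muln1 fact0 expr0 mulr1.
- rewrite bin0n muln0 mulr0 normr_le0 -/(0 == _) [X in X == 0](_ : _ = 0) ?eqxx//.
  elim: j s {sj} => [|j IHj] s; rewrite /= ?expr0 ?subrr//.
  by rewrite -!/(fdiff h j.+1 _ _) !IHj subrr.
- rewrite /= normrX bin0 muln1 fact0 expr0 mulr1 exprn_ile1//.
  by have := sj 0%N isT; rewrite mul0r addr0.
- rewrite (_ : (fun x : R => x ^+ m.+1) = fun x => x * x ^+ m); last first.
    by apply/funext => x; rewrite exprS.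
  rewrite fdiff_idM binS mulnDr natrD [leRHS]mulrDr.
  apply: (le_trans (ler_normD _ _)).
  apply: lerD.
    rewrite normrM -[leRHS]mul1r ler_pM//; first exact: sj.
    exact: IH.
  rewrite normrM ger0_norm ?mulr_ge0//.
  apply: (@le_trans _ _ (j.+1%:R * h * (h ^+ j * (j`! * 'C(m, j))%:R))).
    rewrite ler_wpM2l ?mulr_ge0//; apply: IH => i ij.
    exact/sj/leqW.
  by rewrite factS exprS !natrM le_eqVlt; apply/orP; left; apply/eqP; ring.
Qed.

(** Up to a shift by [h], a cosine is an eigenfunction of the second difference,
    because [cos (t + h) + cos (t - h) = 2 cos h cos t]. *)
Lemma fdiff_cos (R : realType) (h x s : R) (k : nat) :
  fdiff h k.*2 (fun t => cos (t * x)) s =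
  (2 * cos (h * x) - 2) ^+ k * cos ((s + k%:R * h) * x).
Proof.
elim: k s => [|k IH] s; first by rewrite /= mul0r addr0 mul1r.
rewrite doubleS /= !IH -natr1 exprS.
set t := s + k%:R * h.
rewrite (_ : s + h + h + _ = t + h + h); last by rewrite /t; ring.
rewrite (_ : s + h + _ = t + h); last by rewrite /t; ring.
rewrite (_ : s + _ = t + h); last by rewrite /t; ring.
rewrite (_ : cos ((t + h + h) * x) =
  2 * cos (h * x) * cos ((t + h) * x) - cos (t * x)); first ring.
rewrite (_ : (t + h + h) * x = (t + h) * x + h * x); last by ring.
rewrite [X in _ - cos X](_ : t * x = (t + h) * x - h * x); last by ring.
by rewrite cosD cosB; ring.
Qed.

Lemma sum_bin_even (m K : nat) : (\sum_(0 <= k < K) 'C(m, k.*2) <= 2 ^ m)%N.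
Proof.
apply: (@leq_trans (\sum_(0 <= j < K.*2) 'C(m, j))).
  elim: K => [|K IH]; first by rewrite !big_geq.
  rewrite doubleS !big_nat_recr//.
  by rewrite /= -addnA leq_add// leq_addr.
have -> : (2 ^ m = \sum_(0 <= j < m.+1) 'C(m, j))%N.
  rewrite -[2%N]/(1 + 1)%N expnDn big_mkord.
  by apply: eq_bigr => i _; rewrite !exp1n !muln1.
have [le|/ltnW le] := leqP K.*2 m.+1.
  by rewrite [leqRHS](big_cat_nat (n := K.*2))//= leq_addr.
rewrite (big_cat_nat (n := m.+1))//= [X in (_ + X)%N]big1_seq ?addn0//.
by move=> i /andP[_]; rewrite mem_index_iota => /andP[mi _]; rewrite bin_small.
Qed.

(** * Growth of the Gamma function and convergence of the Mittag-Leffler series *)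

(** Half of the exponential decay absorbs any power; the other half is left to
    ensure integrability at infinity. *)
Lemma powR_expRN_le (R : realType) (a : R) : 0 <= a ->
  exists C : R, forall t, 0 <= t -> t `^ a * expR (- t) <= C * expR (- (t / 2)).
Proof.
move=> a0; pose n := (Num.bound a).+1.
have an : a <= n%:R.
  by rewrite (le_trans (ltW (archi_boundP a0)))// ler_nat leqnSn.
exists ((2 * n%:R) ^+ n * expR 2^-1) => t t0.
rewrite (_ : expR (- t) = expR (- (t / 2)) * expR (- (t / 2))); last first.
  by rewrite -expRD; congr expR; field.
rewrite mulrA ler_wpM2r ?expR_ge0// expRN ler_pdivrMr ?expR_gt0//.
apply: (@le_trans _ _ ((1 + t) ^+ n)).
  apply: (@le_trans _ _ ((1 + t) `^ a)).
    by rewrite ge0_ler_powR// ?nnegrE//; lra.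
  by rewrite -powR_mulrn ?ler_powR//; lra.
(* With [e = (1 + t) / (2 n)], [1 + t = 2 n e <= 2 n exp e]; then raise to the
   power [n]. *)
have n0 : 0 < 2 * n%:R :> R by rewrite mulr_gt0.
rewrite -mulrA -expRD -{1}(mulfVK (lt0r_neq0 n0) (1 + t)) mulrC exprMn.
rewrite ler_wpM2l ?exprn_ge0 ?(ltW n0)//.
rewrite (_ : 2^-1 + t / 2 = n%:R * ((1 + t) / (2 * n%:R))); last first.
  by field; rewrite pnatr_eq0.
rewrite expRM_natl lerXn2r ?nnegrE ?expR_ge0 ?divr_ge0 ?(ltW n0)//; first lra.
by rewrite (le_trans _ (expR_ge1Dx _))// lerDr.
Qed.

Lemma measurable_gamma_integrand (R : realType) (a : R)
    (D : set (measurableTypeR R)) : measurable D ->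
  measurable_fun D (fun t : measurableTypeR R => t `^ a * expR (- t)).
Proof.
move=> mD; apply: measurable_funTS; apply: measurable_funM.
  exact: measurable_powR.
by apply: measurableT_comp => //; exact: measurable_expR.
Qed.

Lemma integrable_gamma (R : realType) (a : R) : 0 <= a ->
  (@lebesgue_measure R).-integrable `]0, +oo[
    (EFin \o (fun t : R => t `^ a * expR (- t))).
Proof.
move=> a0; have [C Ct] := @powR_expRN_le R a a0.
have m0 : measurable (`]0, +oo[ : set (measurableTypeR R)).
  exact: measurable_itv.
have eI := integrableZl m0 (2 * C) (integrableS measurableT m0 (@subsetT _ _)
  (@integrable_exponential_pdf R 2^-1 _)).
apply: (le_integrable m0 _ _ (eI _)) => //.
- apply/measurable_EFinP; exact: measurable_gamma_integrand.
- move=> t /=; rewrite in_itv/= andbT => t0.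
  rewrite exponential_pdfE ?(ltW t0)// lee_fin.
  rewrite ger0_norm ?mulr_ge0 ?powR_ge0 ?expR_ge0//.
  rewrite (le_trans (Ct t (ltW t0)))//.
  rewrite (_ : - 2^-1 * t = - (t / 2)); last ring.
  rewrite (_ : 2 * C * _ = C * expR (- (t / 2))); last by field.
  exact: ler_norm.
Qed.

(** The integral over [[M, M + 1]] alone.  As [M] is arbitrary, Gamma grows faster
    than every geometric sequence. *)
Lemma gamma_fun_ge (R : realType) (a M : R) : 0 <= a -> 0 < M ->
  M `^ a * expR (- (M + 1)) <= gamma_fun (a + 1).
Proof.
move=> a0 M0; rewrite /gamma_fun addrK.
have gI := @integrable_gamma R a a0.
rewrite -lee_fin fineK; last exact: integrable_fin_num.
have -> : (M `^ a * expR (- (M + 1)))%:E =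
    (\int[lebesgue_measure]_(t in `[M, (M + 1)%R])
      (M `^ a * expR (- (M + 1)))%:E)%E.
  rewrite integral_cst//= lebesgue_measure_itv/= lte_fin ltrDl ltr01.
  by rewrite -EFinB -EFinM addrAC subrr add0r mulr1.
apply: (@le_trans _ _
  (\int[lebesgue_measure]_(t in `[M, (M + 1)%R]) (t `^ a * expR (- t))%:E)%E).
  apply: ge0_le_integral => //.
  - by move=> t _; rewrite lee_fin mulr_ge0 ?powR_ge0 ?expR_ge0.
  - apply/measurable_EFinP; exact: measurable_gamma_integrand.
  - move=> t /=; rewrite in_itv/= => /andP[Mt tM].
    rewrite lee_fin ler_pM ?powR_ge0 ?expR_ge0//.
      by rewrite ge0_ler_powR// nnegrE; lra.
    by rewrite ler_expR lerN2.
apply: ge0_subset_integral => //.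
- apply/measurable_EFinP; exact: measurable_gamma_integrand.
- by move=> t _; rewrite lee_fin mulr_ge0 ?powR_ge0 ?expR_ge0.
- move=> t /=; rewrite !in_itv/= andbT => /andP[Mt _]; lra.
Qed.

Lemma gamma_fun_gt0 (R : realType) (a : R) : 0 <= a -> 0 < gamma_fun (a + 1).
Proof.
move=> a0; apply: (lt_le_trans _ (@gamma_fun_ge R a 1 a0 ltr01)).
by rewrite powR1 mul1r expR_gt0.
Qed.

Lemma is_cvg_series_mittag_leffler (R : realType) (beta x : R) : 0 < beta ->
  cvgn (series (fun n => x ^+ n / gamma_fun (beta * n%:R + 1))).
Proof.
move=> b0; apply: normed_cvg.
pose r := `|x| + 1; have r0 : 0 < r by rewrite ltr_wpDl.
(* [M ^ beta = 2 r] makes the general term at most a multiple of [2 ^ - n]. *)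
pose M := (2 * r) `^ beta^-1.
have M0 : 0 < M by apply: powR_gt0; rewrite mulr_gt0.
have g0 n : 0 < gamma_fun (beta * n%:R + 1).
  by apply: gamma_fun_gt0; rewrite mulr_ge0// ltW.
apply: (@series_le_cvg _ _ (geometric (expR (M + 1)) 2^-1)) => //.
- by move=> n /=.
- by move=> n; rewrite /geometric/= mulr_ge0 ?expR_ge0 ?exprn_ge0.
- move=> n /=; rewrite normrM normrX normfV (gtr0_norm (g0 n)).
  rewrite ler_pdivrMr//.
  have := @gamma_fun_ge R (beta * n%:R) M.
  rewrite mulr_ge0 ?(ltW b0)// => /(_ isT M0).
  rewrite /M -powRrM mulrA mulVf ?gt_eqF// mul1r -/M.
  rewrite powR_mulrn ?mulr_ge0 ?(ltW r0)// => gM.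
  apply: (@le_trans _ _ (r ^+ n)).
    by rewrite lerXn2r ?nnegrE ?(ltW r0)// /r lerDl.
  apply: (@le_trans _ _ (expR (M + 1) * 2^-1 ^+ n *
      ((2 * r) ^+ n * expR (- (M + 1))))).
    rewrite expRN exprMn exprVn le_eqVlt; apply/orP; left; apply/eqP; field.
    by rewrite expf_neq0//= gt_eqF ?expR_gt0.
  by rewrite ler_wpM2l// /geometric/= mulr_ge0 ?expR_ge0 ?exprn_ge0.
- by apply: is_cvg_geometric_series; rewrite ger0_norm//; lra.
Qed.

Lemma gtc0_real (R : rcfType) (e : R[i]) : 0 < e ->
  0 < complex.Re e /\ e = (complex.Re e)%:C.
Proof. by case: e => a b; rewrite ltcE/= => /andP[/eqP -> a0]. Qed.

Lemma cvg_real_complex (R : realType) (u : nat -> R) (l : R) :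
  u @ \oo --> l -> ((u n)%:C : R[i]^o) @[n --> \oo] --> (l%:C : R[i]^o).
Proof.
move=> /cvgrPdist_lt ul; apply/cvgrPdist_lt => e /gtc0_real[e0 ->].
have := ul _ e0; apply: filterS => n un.
by rewrite -(rmorphB (real_complex R)) normc_def/= expr0n/= addr0 sqrtr_sqr ltcR.
Qed.

(** At real arguments the complex limit defining the Mittag-Leffler function is
    the limit of a real series. *)
Lemma mittag_leffler_real (R : realType) (beta x : R) : 0 < beta ->
  mittag_leffler beta x%:C =
  (limn (series (fun n => x ^+ n / gamma_fun (beta * n%:R + 1))))%:C.
Proof.
move=> b0; rewrite /mittag_leffler.
apply: (@cvg_lim R[i]^o); first exact: norm_hausdorff.
rewrite (_ : series _ = fun n =>
   (series (fun n => x ^+ n / gamma_fun (beta * n%:R + 1)) n)%:C).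
  exact/cvg_real_complex/is_cvg_series_mittag_leffler.
apply/funext => n; rewrite /series/= (rmorph_sum (real_complex R)).
by apply: eq_bigr => i _; rewrite rmorphM/= rmorphXn fmorphV.
Qed.

(** * Exponential moments from an entire characteristic function *)

(** The nonnegative trigonometric weight [2 - 2 cos y = 4 sin (y / 2) ^ 2] is
    comparable to [y ^ 2] near the origin.  The mean value theorem gives
    [sin u >= u cos (1 / 2)] on [[0, 1 / 2]], and [cos (1 / 2) ^ 2 >= 1 / 2]
    because [cos 1 > 0]. *)
Lemma sqr_le_cos (R : realType) (y : R) : `|y| <= 1 ->
  (y / 2) ^+ 2 <= 2 - 2 * cos y.
Proof.
rewrite -(cos_norm y) -[(y / 2) ^+ 2]real_normK ?num_real// normrM normfV.
rewrite (@ger0_norm _ 2)//.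
move: (`|y|) (normr_ge0 y) => {}y y0 y1; pose u := y / 2.
have u0 : 0 <= u by rewrite divr_ge0.
have u1 : u <= 2^-1 by rewrite /u; lra.
have [c] := MVT_segment u0 (fun x _ => @is_derive_sin R x)
  (continuous_subspaceT (@continuous_sin R)).
rewrite in_itv/= sin0 !subr0 => /andP[c0 cu] sinu.
have pi2 := @pi_ge2 R.
have cc : cos 2^-1 <= cos c.
  by rewrite leNgt ltr_cos ?in_itv/= -?leNgt; lra.
have ch : 0 <= cos (2^-1 : R).
  by apply: cos_ge0_pihalf; lra.
have c1 : 2 * cos (2^-1 : R) ^+ 2 >= 1.
  have := @cos1_gt0 R; rewrite [X in cos X](_ : _ = 2^-1 *+ 2); last first.
    by rewrite -[RHS]mulr_natr mulVf.
  rewrite cos_mulr2n; lra.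
have c2 : cos (2^-1 : R) ^+ 2 <= cos c ^+ 2.
  by rewrite lerXn2r// nnegrE// (le_trans ch).
have -> : cos y = 1 - 2 * sin u ^+ 2.
  rewrite (_ : y = u *+ 2) ?cos_mulr2n ?cos2sin2; last first.
    by rewrite -[RHS]mulr_natr divfK.
  by ring.
rewrite -/u sinu [(cos c * u) ^+ 2]exprMn.
have : u ^+ 2 <= 2 * (cos c ^+ 2 * u ^+ 2).
  rewrite mulrA ler_peMl ?sqr_ge0//; apply: (le_trans c1).
  by rewrite ler_wpM2l.
have := sqr_ge0 u.
move: (u ^+ 2) (cos c ^+ 2 * u ^+ 2) => p q; lra.
Qed.

(** The power series of the hyperbolic cosine: the odd terms of the series of
    [expR y] and [expR (- y)] cancel. *)
Lemma cvg_cosh (R : realType) (y : R) :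
  \sum_(0 <= k < K.+1) y ^+ k.*2 / (k.*2)`!%:R @[K --> \oo] -->
  (expR y + expR (- y)) / 2.
Proof.
have sE K : \sum_(0 <= k < K.+1) y ^+ k.*2 / (k.*2)`!%:R =
  (series (exp_coeff y) K.*2.+1 + series (exp_coeff (- y)) K.*2.+1) / 2.
  have eN n : exp_coeff (- y) n.*2 = exp_coeff y n.*2.
    by rewrite /exp_coeff/= exprNn -signr_odd odd_double mul1r.
  have oN n : exp_coeff (- y) n.*2.+1 = - exp_coeff y n.*2.+1.
    by rewrite /exp_coeff/= exprNn -signr_odd/= odd_double mulN1r mulNr.
  rewrite /series/=; elim: K => [|K IH].
    rewrite !big_nat1 (eN 0%N) -[_ / _]/(exp_coeff y 0.*2).
    move: (exp_coeff y _) => e; by field.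
  rewrite big_nat_recr// [LHS]/= IH -[y ^+ _ / _]/(exp_coeff y K.+1.*2).
  rewrite !(@big_nat_recr _ _ _ K.+1.*2)// doubleS.
  rewrite !(@big_nat_recr _ _ _ K.*2.+1)// /= oN -[K.*2.+2]/(K.+1.*2) eN.
  move: (exp_coeff y _) (exp_coeff y _).
  move: (\sum_(_ <= _ < _) _) (\sum_(_ <= _ < _) _).
  move=> p q r t; by field.
under eq_fun do rewrite sE.
have c x : series (exp_coeff x) K.*2.+1 @[K --> \oo] --> expR x.
  have : series (exp_coeff x) @ \oo --> expR x by exact: is_cvg_series_exp_coeff.
  apply: cvg_comp; apply/cvgnyPge => A; exists A => //= n An.
  by rewrite (leq_trans An)// -addnn -addSn leq_addl.
by apply: cvgMl; apply: cvgD; exact: c.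
Qed.

Lemma cvg_limn_einf_le (R : realType) (u : (\bar R)^nat) (S : \bar R) :
  (forall n, u n <= S)%E -> (limn_einf u <= S)%E.
Proof.
move=> uS; rewrite limn_einf_lim; apply: lime_le; first exact: is_cvg_einfs.
apply: nearW => n; apply: le_trans (uS n).
by apply: ereal_inf_lbound; exists n => /=.
Qed.

Section RealIntegrable.
Context d (T : measurableType d) (R : realType) (mu : {measure set T -> \bar R}).
Implicit Types f g : T -> R.

Lemma integrable_add f g : mu.-integrable setT (EFin \o f) ->
  mu.-integrable setT (EFin \o g) ->
  mu.-integrable setT (EFin \o (fun w => f w + g w)).
Proof. by move=> fi gi; exact: (integrableD measurableT fi gi). Qed.

Lemma integrable_sub f g : mu.-integrable setT (EFin \o f) ->
  mu.-integrable setT (EFin \o g) ->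
  mu.-integrable setT (EFin \o (fun w => f w - g w)).
Proof. by move=> fi gi; exact: (integrableB measurableT fi gi). Qed.

Lemma integrable_scale (c : R) f : mu.-integrable setT (EFin \o f) ->
  mu.-integrable setT (EFin \o (fun w => c * f w)).
Proof. by move=> fi; exact: (integrableZl measurableT c fi). Qed.

Lemma Rintegral_dominated f g : measurable_fun setT f ->
  mu.-integrable setT (EFin \o g) -> (forall w, `|f w| <= g w) ->
  mu.-integrable setT (EFin \o f) /\ `|\int[mu]_w f w| <= \int[mu]_w g w.
Proof.
move=> mf ig fg.
have if_ : mu.-integrable setT (EFin \o f).
  apply: le_integrable ig => //; first exact/measurable_EFinP.
  by move=> w _; rewrite lee_fin (le_trans (fg w))// ler_norm.
split=> //; apply: le_trans (le_normr_Rintegral _ if_) _ => //.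
apply: le_Rintegral => //.
apply: le_integrable if_ => //.
  by apply/measurable_EFinP; exact: measurableT_comp.
by move=> w _; rewrite /= normr_id.
Qed.

End RealIntegrable.

(** Let the characteristic function of [X] (its real part) be an even power
    series with coefficients [a].  Absolute convergence at [2], with sum at most
    [S], controls the exponential moments of [X / 2]. *)
Section ExponentialMoment.
Context d (T : measurableType d) (R : realType) (mu : probability T R).
Variables (X : T -> R) (mX : measurable_fun setT X).

Lemma bounded_integrable (f : T -> R) (M : R) : measurable_fun setT f ->
  (forall w, `|f w| <= M) -> mu.-integrable setT (EFin \o f).
Proof.
move=> mf fM; apply: measurable_bounded_integrable => //.
  by rewrite (le_lt_trans (probability_le1 mu measurableT))// ltry.
exists M; split; first exact: num_real.
by move=> x Mx w _ /=; rewrite (le_trans (fM w))// ltW.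
Qed.

Lemma measurable_cosX (s : R) : measurable_fun setT (fun w => cos (s * X w)).
Proof.
apply: measurableT_comp; last exact: measurable_funM.
by apply: continuous_measurable_fun; exact: continuous_cos.
Qed.

Lemma Rintegral_bigsum (n : nat) (f : nat -> T -> R) :
  (forall k, mu.-integrable setT (EFin \o f k)) ->
  mu.-integrable setT (EFin \o (fun w => \sum_(0 <= k < n) f k w)) /\
  \int[mu]_w \sum_(0 <= k < n) f k w = \sum_(0 <= k < n) \int[mu]_w f k w.
Proof.
move=> fi; elim: n => [|n [IHi IHe]].
  rewrite (_ : (fun w => \sum_(0 <= k < 0) f k w) = cst 0); last first.
    by apply/funext => w; rewrite big_geq.
  rewrite Rintegral_cst// mul0r big_geq//; split=> //.
  by apply: (bounded_integrable _ 0) => // w; rewrite normr0.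
split.
  under [X in _.-integrable _ (_ \o X)]eq_fun do rewrite big_nat_recr//.
  exact: integrable_add.
under eq_Rintegral do rewrite big_nat_recr//=.
by rewrite RintegralD// IHe big_nat_recr.
Qed.

Lemma fdiff_Rintegral (h : R) (j : nat) (s : R) :
  mu.-integrable setT (EFin \o (fun w => fdiff h j (fun t => cos (t * X w)) s)) /\
  fdiff h j (fun t => \int[mu]_w cos (t * X w)) s =
  \int[mu]_w fdiff h j (fun t => cos (t * X w)) s.
Proof.
elim: j s => [|j IH] s /=.
  split=> //; apply: (bounded_integrable _ 1); first exact: measurable_cosX.
  by move=> w; exact: cos_max.
split.
  by apply: integrable_sub; [exact: (IH (s + h)).1|exact: (IH s).1].
rewrite !(IH _).2 RintegralB//; [exact: (IH (s + h)).1|exact: (IH s).1].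
Qed.

Variables (a : nat -> R) (S : R).
Hypothesis cos_series : forall s,
  series (fun n => a n * s ^+ n.*2) @ \oo --> \int[mu]_w cos (s * X w).
Hypothesis a_bound : forall N, \sum_(0 <= n < N) `|a n| * 4 ^+ n <= S.

(** The [k]-th summand is a central difference of order [2 k] of the
    characteristic function at the origin, with step [h = 1 / (K + 1)]: the nodes
    [(i - k) h], [i <= 2 k], then lie in [[-1, 1]], and the difference is
    controlled term by term on the power series. *)
Lemma trigonometric_moment_le (K : nat) (h := K.+1%:R^-1) :
  \int[mu]_w (\sum_(0 <= k < K.+1)
     ((2 - 2 * cos (h * X w)) / h ^+ 2) ^+ k / (k.*2)`!%:R) <= S.
Proof.
have h0 : 0 < h by rewrite invr_gt0.
have gE k w : ((2 - 2 * cos (h * X w)) / h ^+ 2) ^+ k / (k.*2)`!%:R =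
   (-1) ^+ k / (h ^+ k.*2 * (k.*2)`!%:R) *
   fdiff h k.*2 (fun t => cos (t * X w)) (- (k%:R * h)).
  rewrite fdiff_cos addNr mul0r cos0 mulr1 -[2 * _ - 2]opprB.
  rewrite [(- (2 - _)) ^+ k]exprNn mulrACA -expr2 sqrr_sign mul1r.
  by rewrite expr_div_n -exprM mul2n invfM -mulrA mulrC.
under eq_Rintegral do under eq_bigr do rewrite gE.
have gI k : mu.-integrable setT (EFin \o (fun w =>
   (-1) ^+ k / (h ^+ k.*2 * (k.*2)`!%:R) *
   fdiff h k.*2 (fun t => cos (t * X w)) (- (k%:R * h)))).
  by apply: integrable_scale; exact: (fdiff_Rintegral _ _ _).1.
rewrite (Rintegral_bigsum _ _ gI).2.
have phi_cvg : \sum_(0 <= k < K.+1) (-1) ^+ k / (h ^+ k.*2 * (k.*2)`!%:R) *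
     fdiff h k.*2 (fun s => series (fun n => a n * s ^+ n.*2) N) (- (k%:R * h))
   @[N --> \oo] --> \sum_(0 <= k < K.+1) \int[mu]_w
    ((-1) ^+ k / (h ^+ k.*2 * (k.*2)`!%:R) *
   fdiff h k.*2 (fun t => cos (t * X w)) (- (k%:R * h))).
  apply: cvg_big => [|k _]; first exact: add_continuous.
  rewrite RintegralZl//; last exact: (fdiff_Rintegral _ _ _).1.
  rewrite -(fdiff_Rintegral _ _ _).2; apply: cvgMr.
  exact: cvg_fdiff.
rewrite -(cvg_lim (@Rhausdorff R) phi_cvg).
apply: limr_le; first by apply/cvg_ex; eexists; exact: phi_cvg.
apply: nearW => N; apply: le_trans (a_bound N).
apply: (@le_trans _ _ (\sum_(0 <= k < K.+1) \sum_(0 <= n < N)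
    `|a n| * 'C(n.*2, k.*2)%:R)).
  rewrite big_nat [leRHS]big_nat; apply: ler_sum => k /andP[_ kK].
  rewrite (le_trans (ler_norm _))// /series/= fdiff_sum normrM.
  have c0 : 0 < h ^+ k.*2 * (k.*2)`!%:R :> R.
    by rewrite mulr_gt0 ?exprn_gt0// ltr0n fact_gt0.
  rewrite normrM normrX normrN1 expr1n mul1r normfV (gtr0_norm c0) mulrC.
  rewrite ler_pdivrMr// mulr_suml (le_trans (ler_norm_sum _ _ _))//.
  apply: ler_sum => n _; rewrite normrM -mulrA ler_wpM2l//.
  apply: (le_trans (ler_norm_fdiff_exp _ _ _ _ _ (ltW h0) _)).
    move=> i ik; rewrite (_ : _ + _ = (i%:R - k%:R) * h); last by ring.
    rewrite normrM (gtr0_norm h0) ler_pdivrMr// mul1r.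
    have ik' : i%:R <= k%:R + k%:R :> R by rewrite -natrD ler_nat addnn.
    have kK' : k%:R <= K.+1%:R :> R by rewrite ler_nat ltnW.
    have i0 := ler0n R i.
    rewrite ler_norml; apply/andP; split; lra.
  by rewrite natrM mulrA [leRHS]mulrC lexx.
rewrite exchange_big/=; apply: ler_sum => n _.
rewrite -mulr_sumr ler_wpM2l// -natr_sum -natrX ler_nat.
by rewrite (leq_trans (sum_bin_even _ _))// -muln2 mulnC expnM.
Qed.

(** On the event [|X| <= K + 1] the trigonometric weights of step [1 / (K + 1)]
    dominate the powers of [X / 2], so their sum dominates a partial sum of
    [cosh (X / 2)].  These truncations converge pointwise to [cosh (X / 2)], which
    is at least half of [expR (X / 2)]. *)
Lemma exponential_moment_le :
  (\int[mu]_w (expR (X w / 2))%:E <= (2 * S)%:E)%E.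
Proof.
pose c K y : R := \sum_(0 <= k < K.+1) y ^+ k.*2 / (k.*2)`!%:R.
pose f K w := (if `|X w| <= K.+1%:R then c K (X w / 2) else 0)%:E.
have c0 K y : 0 <= c K y.
  apply: sumr_ge0 => k _; rewrite divr_ge0// -mul2n exprM exprn_ge0//.
  exact: sqr_ge0.
have f0 K w : (0 <= f K w)%E by rewrite lee_fin; case: ifP.
have mc K : measurable_fun setT (fun w => c K (X w / 2)).
  apply: measurable_sum => k; apply: measurable_funM => //.
  by apply: measurable_funX; apply: measurable_funM.
have mf K : measurable_fun setT (f K).
  apply/measurable_EFinP; apply: measurable_fun_ifT => //.
  by apply: measurable_fun_ler => //; exact: measurableT_comp.
have fcvg w : (f K w @[K --> \oo] -->
    ((expR (X w / 2) + expR (- (X w / 2))) / 2)%:E)%E.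
  apply/fine_cvgP; split; first exact: nearW.
  apply: cvg_trans (@cvg_cosh R (X w / 2)); apply: near_eq_cvg.
  near=> K; rewrite /f/= -/(c K _) ifT//.
  rewrite (le_trans (ltW (archi_boundP (normr_ge0 _))))// ler_nat leqW//.
  by near: K; exists (Num.bound `|X w|).
have fS K : (\int[mu]_w f K w <= S%:E)%E.
  pose h : R := K.+1%:R^-1.
  have h0 : 0 < h by rewrite invr_gt0.
  have gI : mu.-integrable setT (EFin \o (fun w => \sum_(0 <= k < K.+1)
     ((2 - 2 * cos (h * X w)) / h ^+ 2) ^+ k / (k.*2)`!%:R)).
    apply: (Rintegral_bigsum K.+1 _ _).1 => k.
    apply: (bounded_integrable _ ((4 / h ^+ 2) ^+ k / (k.*2)`!%:R)).
      apply: measurable_funM => //; apply: measurable_funX.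
      apply: measurable_funM => //; apply: measurable_funB => //.
      by apply: measurable_funM => //; exact: measurable_cosX.
    move=> w; have := cos_geN1 (h * X w); have := cos_le1 (h * X w) => c1 cN1.
    rewrite normrM normfV normr_nat ler_wpM2r ?invr_ge0// normrX.
    rewrite lerXn2r ?nnegrE ?divr_ge0 ?exprn_ge0 ?(ltW h0)//.
    rewrite normrM normfV normrX (gtr0_norm h0) ler_wpM2r//.
      by rewrite invr_ge0 exprn_ge0 ?(ltW h0).
    by rewrite ger0_norm; lra.
  apply: le_trans (_ : (_ <= (\int[mu]_w (\sum_(0 <= k < K.+1)
     ((2 - 2 * cos (h * X w)) / h ^+ 2) ^+ k / (k.*2)`!%:R))%:E)%E) _; last first.
    by rewrite lee_fin; exact: trigonometric_moment_le.
  rewrite fineK ?integrable_fin_num//.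
  apply: ge0_le_integral => //.
    exact: measurable_int gI.
  move=> w _; rewrite lee_fin.
  have [XK|_] := boolP (`|X w| <= _); last first.
    rewrite sumr_ge0// => k _; rewrite divr_ge0// exprn_ge0//.
    by rewrite divr_ge0 ?exprn_ge0 ?(ltW h0)//.
  apply: ler_sum => k _; rewrite ler_wpM2r ?invr_ge0//.
  rewrite -mul2n exprM lerXn2r ?nnegrE ?sqr_ge0//.
    by rewrite divr_ge0 ?exprn_ge0 ?(ltW h0)//.
  rewrite ler_pdivlMr ?exprn_gt0//.
  apply: le_trans (sqr_le_cos _ (h * X w) _).
    by rewrite !exprMn mulrC mulrA.
  by rewrite normrM (gtr0_norm h0) mulrC ler_pdivrMr// mul1r.
have : (\int[mu]_w ((expR (X w / 2) + expR (- (X w / 2))) / 2)%:E <= S%:E)%E.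
  apply: le_trans (cvg_limn_einf_le _ _ _ fS).
  apply: le_trans (fatou mu measurableT mf (fun K w _ => f0 K w)).
  rewrite le_eqVlt; apply/orP; left; apply/eqP; apply: eq_integral => w _.
  by rewrite (cvg_limn_einf_sup (fcvg w)).1.
have mexp : measurable_fun setT (fun w => expR (X w / 2)).
  by apply: measurableT_comp => //; exact: measurable_funM.
have mexpN : measurable_fun setT (fun w => expR (- (X w / 2))).
  apply: measurableT_comp => //; apply: measurableT_comp => //.
  exact: measurable_funM.
move=> coshS.
apply: (@le_trans _ _ (2%:E *
    \int[mu]_w ((expR (X w / 2) + expR (- (X w / 2))) / 2)%:E)%E); last first.
  by rewrite EFinM lee_wpmul2l.
rewrite -ge0_integralZl//; last first.
- apply/measurable_EFinP; apply: measurable_funM => //.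
  exact: measurable_funD.
apply: ge0_le_integral => //.
- exact/measurable_EFinP.
- apply/measurable_EFinP; apply: measurable_funM => //.
  apply: measurable_funM => //; exact: measurable_funD.
- move=> w _; rewrite -EFinM lee_fin [leRHS]mulrC divfK// lerDl expR_ge0//.
Unshelve. all: by end_near. Qed.

End ExponentialMoment.

(** * Exponential moments of the Mittag-Leffler measure *)

Section MittagLefflerMeasure.
Context (R : realType) (T : nuclear_triple R).

Lemma measurable_pairing (phi : nuclear T) :
  measurable_fun setT (fun w : nuclear_dual T => pairing w phi).
Proof.
move=> _ B mB; rewrite setTI; apply: sub_sigma_algebra.
exists 1%N, (fun=> phi), (fun=> B); split=> //.
by apply/seteqP; split=> [w Bw _//|w /(_ ord0)].
Qed.

Lemma pairingZ (s : R) (w : nuclear_dual T) (phi : nuclear T) :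
  pairing w (s *: phi) = s * pairing w phi.
Proof. by rewrite /pairing linearZ. Qed.

Lemma pairingD (w : nuclear_dual T) (phi psi : nuclear T) :
  pairing w (phi + psi) = pairing w phi + pairing w psi.
Proof. by rewrite /pairing linearD. Qed.

Lemma pairingB (w : nuclear_dual T) (phi psi : nuclear T) :
  pairing w (phi - psi) = pairing w phi - pairing w psi.
Proof. by rewrite /pairing linearB. Qed.

Context (beta : R) (beta_gt0 : 0 < beta) (mu : probability (nuclear_dual T) R)
  (mu_beta : is_mittag_leffler_measure beta mu).

(** The real part of the identity defining [mu], at [s *: phi]. *)
Lemma cos_pairing_series (phi : nuclear T) (s : R) :
  series (fun n => (- (2^-1 * `|phi : hs T 0| ^+ 2)) ^+ n /
    gamma_fun (beta * n%:R + 1) * s ^+ n.*2) @ \oo -->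
  \int[mu]_w cos (s * pairing w phi).
Proof.
have E : \int[mu]_w complex.Re (cexp ('i * (pairing w (s *: phi))%:C)) = limn _ :=
  congr1 (@complex.Re R)
    (etrans (mu_beta (s *: phi)) (mittag_leffler_real _ _ _ beta_gt0)).
rewrite (_ : \int[mu]_w cos _ =
    \int[mu]_w complex.Re (cexp ('i * (pairing w (s *: phi))%:C))); last first.
  apply: eq_Rintegral => w _; rewrite pairingZ /cexp/=.
  by rewrite !(mul0r, mul1r, mulr0, subr0, add0r, addr0) oppr0 expR0 mul1r.
rewrite E (_ : (fun n => _ * s ^+ n.*2) = fun n =>
  (- (2^-1 * inner (s *: phi : hs T 0) (s *: phi : hs T 0))) ^+ n /
    gamma_fun (beta * n%:R + 1)); first exact: is_cvg_series_mittag_leffler.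
apply/funext => n; rewrite inner_norm normrZ exprMn real_normK ?num_real//.
rewrite -mul2n exprM mulrAC -exprMn; congr (_ ^+ _ / _); ring.
Qed.

(** Twice [E_beta (8 Q)].  The argument 8 is [4 * (1 / 2) * 4]: the squared norm
    of [2 *: phi], the factor in the characteristic function, and the ratio [4 ^ n]
    of the binomial sums. *)
Definition mittag_leffler_bound (Q : R) : R :=
  2 * limn (series (fun n => (8 * Q) ^+ n / gamma_fun (beta * n%:R + 1))).

(** The exponential moment estimate for [X w = <w, 2 phi>]. *)
Lemma expR_pairing_le (phi : nuclear T) (Q : R) : `|phi : hs T 0| ^+ 2 <= Q ->
  (\int[mu]_w (expR (pairing w phi))%:E <= (mittag_leffler_bound Q)%:E)%E.
Proof.
move=> phiQ.
have Q0 : 0 <= Q by rewrite (le_trans _ phiQ)// exprn_ge0.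
have g0 n : 0 < gamma_fun (beta * n%:R + 1).
  by apply: gamma_fun_gt0; rewrite mulr_ge0// ltW.
have t0 n : 0 <= (8 * Q) ^+ n / gamma_fun (beta * n%:R + 1).
  by rewrite divr_ge0 ?exprn_ge0 ?mulr_ge0// ltW.
have := @exponential_moment_le _ _ _ mu _ (measurable_pairing (2 *: phi)) _
  (limn (series (fun n => (8 * Q) ^+ n / gamma_fun (beta * n%:R + 1))))
  (cos_pairing_series (2 *: phi)).
under eq_integral do rewrite pairingZ mulrC mulKf//.
apply=> N.
apply: (@le_trans _ _ (series (fun n =>
    (8 * Q) ^+ n / gamma_fun (beta * n%:R + 1)) N)); last first.
  apply: nondecreasing_cvgn_le; last exact: is_cvg_series_mittag_leffler.
  by apply/nondecreasing_seqP => n; rewrite /series/= big_nat_recr//= lerDl.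
apply: ler_sum => n _; rewrite normrM normfV (gtr0_norm (g0 n)) mulrAC.
rewrite ler_wpM2r ?invr_ge0 ?(ltW (g0 n))// normrX -exprMn lerXn2r ?nnegrE//.
- by rewrite mulr_ge0.
rewrite normrN ger0_norm ?mulr_ge0 ?exprn_ge0//.
rewrite [nuclear_val _](_ : _ = 2 *: (phi : hs T 0))// normrZ exprMn.
by rewrite (@ger0_norm _ 2)//; lra.
Qed.

Lemma integrable_expR_pairing (phi : nuclear T) :
  mu.-integrable setT (EFin \o (fun w => expR (pairing w phi))).
Proof.
apply/integrableP; split.
  apply/measurable_EFinP; apply: measurableT_comp => //.
  exact: measurable_pairing.
apply: (@le_lt_trans _ _ (\int[mu]_w (expR (pairing w phi))%:E)%E).
  by under eq_integral do rewrite /= ger0_norm ?expR_ge0//.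
exact: le_lt_trans (expR_pairing_le _ _ (lexx _)) (ltry _).
Qed.

End MittagLefflerMeasure.

(** * First-order expansion of the Laplace transform *)

(** Taylor's formula at order 2 with a cruder constant, by two applications of the
    mean value theorem. *)
Lemma second_order_le (R : realType) (f f' f'' : R -> R) (M : R) :
  (forall t : R, is_derive t 1 f (f' t)) ->
  (forall t : R, is_derive t 1 f' (f'' t)) ->
  (forall t, 0 <= t <= 1 -> `|f'' t| <= M) -> `|f 1 - f 0 - f' 0| <= M.
Proof.
move=> df df' f''M.
have cont (g g' : R -> R) a b : (forall t : R, is_derive t 1 g (g' t)) ->
    {within `[a, b], continuous g}.
  move=> dg; apply: derivable_within_continuous => x _.
  exact: (@ex_derive _ _ _ _ _ _ _ (dg x)).
have [c] := MVT_segment ler01 (fun t _ => df t) (cont _ _ _ _ df).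
rewrite in_itv/= subr0 mulr1 => /andP[c0 c1] ->.
have [b] := MVT_segment c0 (fun t _ => df' t) (cont _ _ _ _ df').
rewrite in_itv/= subr0 => /andP[b0 bc] ->.
rewrite normrM (ger0_norm c0) -[M]mulr1 ler_pM//.
by apply: f''M; rewrite b0 (le_trans bc).
Qed.

(** The real part of a bound of [exp (A + z) - exp A - z exp A], for
    [A = a + i b] and [z = x + i y], from the second derivative along the segment
    from [A] to [A + z]. *)
Lemma expR_cos_second_order (R : realType) (a b x y : R) :
  `|expR (a + x) * cos (b + y) - expR a * cos b
    - expR a * (x * cos b - y * sin b)| <= expR (a + `|x|) * (`|x| + `|y|) ^+ 2.
Proof.
pose f t := expR (a + t * x) * cos (b + t * y).
pose f' t := expR (a + t * x) * (x * cos (b + t * y) - y * sin (b + t * y)).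
pose f'' t := expR (a + t * x) *
  ((x ^+ 2 - y ^+ 2) * cos (b + t * y) - 2 * x * y * sin (b + t * y)).
have := @second_order_le R f f' f'' (expR (a + `|x|) * (`|x| + `|y|) ^+ 2).
rewrite /f /f' !mul1r !mul0r !addr0; apply.
- move=> t; apply: is_derive_eq; rewrite /GRing.scale/=; ring.
- move=> t; apply: is_derive_eq; rewrite /GRing.scale/=; rewrite /f''; ring.
move=> t /andP[t0 t1]; rewrite /f'' normrM ger0_norm ?expR_ge0//.
rewrite ler_pM ?expR_ge0//.
  rewrite ler_expR lerD2l (le_trans (ler_norm _))// normrM (ger0_norm t0).
  by rewrite ler_piMl.
rewrite (le_trans (ler_normB _ _))// !normrM (@ger0_norm _ 2)//.
rewrite (_ : (`|x| + `|y|) ^+ 2 = (`|x| ^+ 2 + `|y| ^+ 2) * 1 +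
  2 * `|x| * `|y| * 1); last by ring.
rewrite lerD//; apply: ler_pM => //.
- by rewrite (le_trans (ler_normB _ _))// !normrX.
- exact: cos_max.
- exact: sin_max.
Qed.

(** The imaginary part of the same estimate, as the sine is a shifted cosine. *)
Lemma expR_sin_second_order (R : realType) (a b x y : R) :
  `|expR (a + x) * sin (b + y) - expR a * sin b
    - expR a * (x * sin b + y * cos b)| <= expR (a + `|x|) * (`|x| + `|y|) ^+ 2.
Proof.
have := @expR_cos_second_order R a (b - pi / 2) x y.
by rewrite [b - _ + y]addrAC !cosBpihalf sinBpihalf mulrN opprK.
Qed.

(** Absorbs the quadratic factor of the Taylor remainder in the exponential. *)
Lemma sqrM_expR_le (R : realType) (b : R) : 0 <= b ->
  b ^+ 2 * expR b <= 2 * expR (2 * b).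
Proof.
move=> b0; have -> : expR (2 * b) = expR b * expR b.
  by rewrite -expRD -mulr2n mulr_natl.
rewrite mulrA ler_wpM2r ?expR_ge0//.
have := @expR_ge1Dxn R b 1 b0; rewrite -[2`!]/2%N.
by move: (b ^+ 2) (expR b) => p q; lra.
Qed.

(** Removes the absolute values from an exponent: one of the four sign choices
    realises them. *)
Lemma expR_norm2_le (R : realType) (a b c : R) :
  expR (a + (`|b| + `|c|)) <= (expR (a + b + c) + expR (a + b - c)) +
    (expR (a - b + c) + expR (a - b - c)).
Proof.
have e := @expR_gt0 R; have := e (a + b + c); have := e (a + b - c).
have := e (a - b + c); have := e (a - b - c).
by have [b0|b0] := ger0P b; have [c0|c0] := ger0P c; rewrite addrA; lra.
Qed.

(** From here on [mu] is any probability measure having all real exponential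
    moments. *)
Section Laplace.
Context (R : realType) (T : nuclear_triple R).
Variables (mu : probability (nuclear_dual T) R).
Hypothesis exp_mu : forall phi : nuclear T,
  mu.-integrable setT (EFin \o (fun w => expR (pairing w phi))).

Lemma measurable_cexp_pairing (phi : complexification (nuclear T)) :
  measurable_fun setT (fun w => complex.Re (cexp (cpairing w phi))) /\
  measurable_fun setT (fun w => complex.Im (cexp (cpairing w phi))).
Proof.
have [mcos msin] : measurable_fun setT (@cos R) /\ measurable_fun setT (@sin R).
  by split; apply: continuous_measurable_fun;
    [exact: continuous_cos|exact: continuous_sin].
have mexp : measurable_fun setT (fun w => expR (pairing w phi.1)).
  by apply: measurableT_comp => //; exact: measurable_pairing.
by split; apply: measurable_funM => //; apply: measurableT_comp => //;
  exact: measurable_pairing.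
Qed.

Lemma cexp_pairing_dominated (phi : complexification (nuclear T)) :
  cintegrable mu (fun w => cexp (cpairing w phi)) /\
  (`|complex.Re (laplace_transform mu phi)| <=
     \int[mu]_w expR (pairing w phi.1) /\
   `|complex.Im (laplace_transform mu phi)| <=
     \int[mu]_w expR (pairing w phi.1)).
Proof.
have [mR mI] := measurable_cexp_pairing phi.
have [|iR lR] := Rintegral_dominated _ _ _ _ _ _ mR (exp_mu phi.1).
  move=> w; rewrite normrM ger0_norm ?expR_ge0//.
  by rewrite ler_piMr ?expR_ge0// cos_max.
have [|iI lI] := Rintegral_dominated _ _ _ _ _ _ mI (exp_mu phi.1).
  move=> w; rewrite normrM ger0_norm ?expR_ge0//.
  by rewrite ler_piMr ?expR_ge0// sin_max.
by [].
Qed.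

(** First-order expansion of the transform in the complex direction [phi], with
    [D1 + i D2] the integral of [B exp A], where [A] and [B] are the pairings with
    [psi] and [phi]. *)
Lemma laplace_first_order (psi phi : complexification (nuclear T)) :
  exists (D1 D2 C : R), forall h1 h2 : R, `|h1| + `|h2| <= 1 ->
    let L := laplace_transform mu (psi + (h1 +i* h2) *: phi) -
             laplace_transform mu psi in
    `|complex.Re L - (h1 * D1 - h2 * D2)| <= (`|h1| + `|h2|) ^+ 2 * C /\
    `|complex.Im L - (h1 * D2 + h2 * D1)| <= (`|h1| + `|h2|) ^+ 2 * C.
Proof.
pose a1 w := pairing w psi.1; pose a2 w := pairing w psi.2.
pose b1 w := pairing w phi.1; pose b2 w := pairing w phi.2.
pose b w := `|b1 w| + `|b2 w|.
(* An integrable majorant of [exp (Re A + 2 |Re B| + 2 |Im B|)]. *)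
pose G w := (expR (a1 w + 2 * b1 w + 2 * b2 w) +
             expR (a1 w + 2 * b1 w - 2 * b2 w)) +
            (expR (a1 w - 2 * b1 w + 2 * b2 w) +
             expR (a1 w - 2 * b1 w - 2 * b2 w)).
have b0 w : 0 <= b w by rewrite addr_ge0.
have leG w : expR (a1 w + 2 * b w) <= G w.
  rewrite (_ : 2 * b w = `|2 * b1 w| + `|2 * b2 w|); last first.
    by rewrite !normrM (@ger0_norm _ 2)// -mulrDr.
  exact: expR_norm2_le.
have leG1 w : expR (a1 w) * b w <= G w.
  apply: le_trans (leG w); rewrite expRD ler_wpM2l ?expR_ge0//.
  by rewrite (le_trans _ (expR_ge1Dx _))//; have := b0 w; lra.
have iG : mu.-integrable setT (EFin \o G).
  have ipsi (s t : R) (p : nuclear T) : p = psi.1 + s *: phi.1 + t *: phi.2 ->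
    mu.-integrable setT
      (EFin \o (fun w => expR (a1 w + s * b1 w + t * b2 w))).
    move=> pE; have := exp_mu p; rewrite pE.
    by under eq_fun do rewrite !pairingD !pairingZ.
  apply: integrable_add; apply: integrable_add.
  - exact: (ipsi 2 2).
  - by under eq_fun do rewrite -[- (2 * b2 _)]mulNr; exact: (ipsi 2 (- 2)).
  - by under eq_fun do rewrite -[- (2 * b1 _)]mulNr; exact: (ipsi (- 2) 2).
  - under eq_fun do rewrite -[- (2 * b1 _)]mulNr -[- (2 * b2 _)]mulNr.
    exact: (ipsi (- 2) (- 2)).
have ma1 : measurable_fun setT a1 by exact: measurable_pairing.
have ma2 : measurable_fun setT a2 by exact: measurable_pairing.
have mb1 : measurable_fun setT b1 by exact: measurable_pairing.
have mb2 : measurable_fun setT b2 by exact: measurable_pairing.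
have mcos : measurable_fun setT (fun w => cos (a2 w)).
  apply: measurableT_comp => //.
  by apply: continuous_measurable_fun; exact: continuous_cos.
have msin : measurable_fun setT (fun w => sin (a2 w)).
  apply: measurableT_comp => //.
  by apply: continuous_measurable_fun; exact: continuous_sin.
have mexp : measurable_fun setT (fun w => expR (a1 w)).
  exact: measurableT_comp.
pose u w := expR (a1 w) * (b1 w * cos (a2 w) - b2 w * sin (a2 w)).
pose v w := expR (a1 w) * (b1 w * sin (a2 w) + b2 w * cos (a2 w)).
have mu_u : measurable_fun setT u.
  by apply: measurable_funM => //; apply: measurable_funB; exact: measurable_funM.
have mu_v : measurable_fun setT v.
  by apply: measurable_funM => //; apply: measurable_funD; exact: measurable_funM.
have uG w : `|u w| <= G w.
  apply: le_trans (leG1 w).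
  rewrite normrM ger0_norm ?expR_ge0// ler_wpM2l ?expR_ge0//.
  rewrite (le_trans (ler_normB _ _))// !normrM.
  by rewrite lerD// ler_piMr// ?cos_max ?sin_max.
have vG w : `|v w| <= G w.
  apply: le_trans (leG1 w).
  rewrite normrM ger0_norm ?expR_ge0// ler_wpM2l ?expR_ge0//.
  rewrite (le_trans (ler_normD _ _))// !normrM.
  by rewrite lerD// ler_piMr// ?cos_max ?sin_max.
have [iu _] := Rintegral_dominated _ _ _ mu u G mu_u iG uG.
have [iv _] := Rintegral_dominated _ _ _ mu v G mu_v iG vG.
exists (\int[mu]_w u w), (\int[mu]_w v w), (2 * \int[mu]_w G w) => h1 h2 h_le1.
set eta := `|h1| + `|h2| in h_le1 *.
have eta0 : 0 <= eta by rewrite addr_ge0.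
(* [x + i y] is the increment [(h1 + i h2) B] of the exponent. *)
pose x w := h1 * b1 w - h2 * b2 w; pose y w := h1 * b2 w + h2 * b1 w.
have [[iR iI] _] := cexp_pairing_dominated (psi + (h1 +i* h2) *: phi).
have [[iR0 iI0] _] := cexp_pairing_dominated psi.
have pE1 w : pairing w (psi + (h1 +i* h2) *: phi).1 = a1 w + x w.
  by rewrite pairingD pairingB !pairingZ.
have pE2 w : pairing w (psi + (h1 +i* h2) *: phi).2 = a2 w + y w.
  by rewrite pairingD pairingD !pairingZ.
have xy_le w : expR (a1 w + `|x w|) * (`|x w| + `|y w|) ^+ 2 <=
    eta ^+ 2 * 2 * G w.
  have xyb : `|x w| + `|y w| <= eta * b w.
    rewrite (le_trans (lerD (ler_normB _ _) (ler_normD _ _)))// !normrM.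
    by rewrite /eta /b le_eqVlt; apply/orP; left; apply/eqP; ring.
  have xb : `|x w| <= b w.
    rewrite (le_trans (le_trans _ xyb))// ?lerDl//.
    by rewrite ler_piMl.
  apply: (@le_trans _ _ (expR (a1 w + b w) * (eta * b w) ^+ 2)).
    rewrite ler_pM ?expR_ge0 ?sqr_ge0// ?ler_expR ?lerD2l//.
    by rewrite lerXn2r// nnegrE ?addr_ge0// mulr_ge0.
  rewrite [leLHS](_ : _ = eta ^+ 2 * (expR (a1 w) * (b w ^+ 2 * expR (b w))));
    last by rewrite expRD exprMn; ring.
  rewrite -mulrA ler_wpM2l ?sqr_ge0//.
  apply: (@le_trans _ _ (expR (a1 w) * (2 * expR (2 * b w)))).
    by rewrite ler_wpM2l ?expR_ge0// sqrM_expR_le.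
  by rewrite mulrCA -expRD ler_wpM2l.
have iMG c : mu.-integrable setT (EFin \o (fun w => c * G w)).
  exact: integrable_scale.
have ihu h : mu.-integrable setT (EFin \o (fun w => h * u w)).
  exact: integrable_scale.
have ihv h : mu.-integrable setT (EFin \o (fun w => h * v w)).
  exact: integrable_scale.
have mint f : mu.-integrable setT (EFin \o f) -> measurable_fun setT f.
  by move=> /measurable_int /measurable_EFinP.
split.
- rewrite /= -!RintegralZl// -!RintegralB//; [|exact: integrable_sub..].
  apply: (Rintegral_dominated _ _ _ _ _ _ _ _ _).2.
  - by apply: mint; apply: integrable_sub; exact: integrable_sub.
  - by apply: integrable_scale; exact: iMG.
  move=> w; rewrite /= pE1 pE2 mulrA; apply: le_trans (xy_le w).
  apply: le_trans (expR_cos_second_order _ (a1 w) (a2 w) (x w) (y w)).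
  rewrite le_eqVlt; apply/orP; left; apply/eqP; congr (`| _ |).
  rewrite /u /v /x /y.
  by ring.
- rewrite /= -!RintegralZl// -RintegralD// -!RintegralB//;
    [|exact: integrable_sub|exact: integrable_add].
  apply: (Rintegral_dominated _ _ _ _ _ _ _ _ _).2.
  - apply: mint; apply: integrable_sub; first exact: integrable_sub.
    exact: integrable_add.
  - by apply: integrable_scale; exact: iMG.
  move=> w; rewrite /= pE1 pE2 mulrA; apply: le_trans (xy_le w).
  apply: le_trans (expR_sin_second_order _ (a1 w) (a2 w) (x w) (y w)).
  rewrite le_eqVlt; apply/orP; left; apply/eqP; congr (`| _ |).
  rewrite /u /v /x /y.
  by ring.
Qed.

End Laplace.

(** * Holomorphy *)

Lemma normc_le_Re_Im (R : rcfType) (z : R[i]) (M : R) :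
  `|complex.Re z| <= M -> `|complex.Im z| <= M -> `|z| <= (2 * M)%:C.
Proof.
move=> zR zI; have M0 : 0 <= M by exact: le_trans zR.
rewrite normc_def lecR -(@ler_pXn2r _ 2) ?nnegrE ?sqrtr_ge0 ?mulr_ge0//.
rewrite sqr_sqrtr ?addr_ge0 ?sqr_ge0// -[X in X + _]real_normK ?num_real//.
rewrite -[X in _ + X]real_normK ?num_real//.
apply: (@le_trans _ _ (M ^+ 2 + M ^+ 2)).
  by rewrite lerD// lerXn2r// nnegrE.
by rewrite exprMn; have := sqr_ge0 M; lra.
Qed.

Lemma Re_Im_le_normc (R : rcfType) (z : R[i]) :
  `|complex.Re z| + `|complex.Im z| <= 2 * complex.Re `|z|.
Proof.
rewrite normc_def/= mulr2n mulrDl !mul1r.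
by rewrite lerD// -sqrtr_sqr ler_wsqrtr// ?lerDl ?lerDr sqr_ge0.
Qed.

(** A remainder quadratic in [h] is enough for complex differentiability. *)
Lemma gholomorphic_first_order (R : realType) (E : lmodType R[i])
    (F : E -> R[i]) :
  (forall psi phi : E, exists (D : R[i]) (C : R),
    forall h : R[i], `|complex.Re h| + `|complex.Im h| <= 1 ->
      `|F (psi + h *: phi) - F psi - h * D| <=
        ((`|complex.Re h| + `|complex.Im h|) ^+ 2 * C)%:C) ->
  gholomorphic F.
Proof.
move=> FD phi0 phi z; have [D [C DC]] := FD (phi0 + z *: phi) phi.
apply/cvg_ex; exists (D : R[i]^o); apply/cvgrPdist_le => e /gtc0_real[e0 ->].
set d := complex.Re e in e0 *.
(* The remainder is at most [eta ^ 2 C'] with [eta <= 2 |h|], hence at most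
   [4 C' r |h|] when [|h| < r]. *)
pose C' := `|C| + 1; have C'0 : 0 < C' by rewrite ltr_wpDl.
pose r := Num.min 2^-1 (d / (4 * C')).
have r0 : 0 < r.
  by rewrite lt_min invr_gt0 divr_gt0 ?mulr_gt0 // ltr0n.
near=> h.
have h0 : h != 0 :> R[i] by near: h; exact: nbhs_dnbhs_neq.
pose n := complex.Re `|h : R[i]|.
have nE : `|h : R[i]| = n%:C by rewrite /n normc_def.
have n_r : n < r.
  rewrite -ltcR -nE; near: h.
  by apply: (@dnbhs0_lt _ R[i]^o); rewrite ltcR.
set eta := `|complex.Re h| + `|complex.Im h|.
have eta_n : eta <= 2 * n := Re_Im_le_normc _ h.
have eta2r : eta <= 2 * r by lra.
have eta1 : eta <= 1.
  apply: (le_trans eta2r).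
  have : r <= 2^-1 by rewrite ge_min lexx.
  lra.
have eta0 : 0 <= eta by rewrite addr_ge0.
have := DC h eta1; rewrite -/eta => DCh.
rewrite -normrN opprB [h^-1 *: _](_ : _ = h^-1 *
    (F (phi0 + z *: phi + h *: phi) - F (phi0 + z *: phi))); last first.
  congr (_ * (F _ - _)); rewrite /= [h *: 1]mulr1 scalerDl.
  by rewrite addrCA addrC.
rewrite (_ : _ - D = h^-1 * (F (phi0 + z *: phi + h *: phi) -
    F (phi0 + z *: phi) - h * D)); last first.
  by rewrite [RHS]mulrBr mulKf.
rewrite normrM normfV ler_pdivrMl ?normr_gt0//.
apply: (le_trans DCh).
apply: (@le_trans _ _ ((eta * (2 * r * C'))%:C)).
  rewrite lecR expr2 -!mulrA ler_wpM2l//.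
  apply: (@le_trans _ _ (eta * C')).
    rewrite ler_wpM2l// /C'; have := ler_norm C; lra.
  by rewrite mulrA ler_wpM2r// ltW.
rewrite nE -rmorphM/= lecR.
apply: (@le_trans _ _ (2 * n * (2 * r * C'))).
  by rewrite ler_wpM2r// ltW// !mulr_gt0.
rewrite [leLHS](_ : _ = n * (r * (4 * C'))); last by ring.
have n0 : 0 <= n by have := normr_ge0 (h : R[i]); rewrite nE ler0c.
rewrite ler_wpM2l// -ler_pdivlMr ?mulr_gt0//.
by rewrite ge_min lexx orbT.
Unshelve. all: by end_near. Qed.

(** The inclusion in the central Hilbert space is the coordinate of index 0 of the
    projective limit. *)
Lemma nuclear_val_continuous (R : realType) (T : nuclear_triple R) :
  continuous (fun phi : nuclear T => (phi : hs T 0)).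
Proof.
have -> : (fun phi : nuclear T => (phi : hs T 0)) =
    (fun c : prod_topology (fun p => hs T p) => c 0%N) \o @nuclear_coord R T.
  by apply/funext => phi /=; exact: esym (nuclear_coordP phi 0%N).
move=> phi; apply: continuous_comp.
  exact: initial_continuous.
exact: proj_continuous.
Qed.

(** On the neighbourhood [|Re y|_0 < |Re x|_0 + 1] of [x], the exponential moment
    of the real part bounds the transform uniformly. *)
Lemma laplace_transform_bounded (R : realType) (T : nuclear_triple R) (beta : R)
    (mu : probability (nuclear_dual T) R) : 0 < beta ->
  is_mittag_leffler_measure beta mu ->
  @locally_bounded R (complexification (nuclear T)) (laplace_transform mu).
Proof.
move=> beta_gt0 mu_beta x.
have exp_mu := integrable_expR_pairing _ _ _ beta_gt0 _ mu_beta.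
pose Q := (`|nuclear_val x.1| + 1) ^+ 2.
pose M := mittag_leffler_bound R beta Q.
have le_M (y : complexification (nuclear T)) :
    `|nuclear_val y.1| < `|nuclear_val x.1| + 1 ->
    `|laplace_transform mu y| <= (2 * M)%:C.
  move=> yx.
  have IM : \int[mu]_w expR (pairing w y.1) <= M.
    rewrite -lee_fin fineK; last exact: integrable_fin_num (exp_mu _).
    apply: expR_pairing_le => //.
    by rewrite lerXn2r ?nnegrE// ?addr_ge0// ltW.
  have [_ [yR yI]] := cexp_pairing_dominated _ _ _ exp_mu y.
  by apply: normc_le_Re_Im; apply: le_trans IM.
have near_x : \forall y \near x, `|nuclear_val y.1| < `|nuclear_val x.1| + 1.
  have cont : (fun y : complexification (nuclear T) => `|nuclear_val y.1|) y
      @[y --> x] --> `|nuclear_val x.1|.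
    apply: cvg_norm; apply: continuous_comp.
      exact: cvg_fst.
    exact: nuclear_val_continuous.
  apply: (cvgr_lt _ cont); rewrite ltrDl//.
rewrite /bounded_near; near=> B.
have MB : (2 * M)%:C <= B.
  near: B; apply: nbhs_pinfty_ge.
  by apply/ger0_real/(le_trans (normr_ge0 _))/(le_M x); rewrite ltrDl.
by apply: filterS near_x => y yx /=; exact: le_trans (le_M y yx) MB.
Unshelve. all: by end_near. Qed.

Theorem theorem4p2 (R : realType) (T : nuclear_triple R) (beta : R)
    (beta_gt0 : 0 < beta) (beta_le1 : beta <= 1)
    (mu : probability (nuclear_dual T) R)
    (mu_beta : is_mittag_leffler_measure beta mu) :
  (forall phi : complexification (nuclear T),
     cintegrable mu (fun w : nuclear_dual T => cexp (cpairing w phi))) /\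
  @holomorphic R (complexification (nuclear T)) (laplace_transform mu).
Proof.
have exp_mu := integrable_expR_pairing _ _ _ beta_gt0 _ mu_beta.
split=> [phi|]; first exact: (cexp_pairing_dominated _ _ _ exp_mu phi).1.
split; first exact: laplace_transform_bounded beta_gt0 mu_beta.
apply: gholomorphic_first_order => psi phi.
have [D1 [D2 [C DC]]] := laplace_first_order _ _ _ exp_mu psi phi.
exists (D1 +i* D2), (2 * C) => -[h1 h2] /= /DC[DR DI].
by rewrite mulrCA; apply: normc_le_Re_Im.
Qed.
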